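(* Let $\varepsilon>0$. Suppose $f$ is differentiable on $X$ and its gradient satisfies $\|\nabla f(x)-\nabla f(y)\|_*\le L\|x-y\|$ for all $x,y\in X$. Apply Algorithm B (described in the context) to the problem of minimizing $f(x)$ over $x\in X$ subject to $g_m(x)\le0$ for all $m=1,\dots,M$. Then after Algorithm B stops (with final counter value $N$), $$\min_{0\le k\le N}f(x^k)-f(x_* )\le\varepsilon_f+\frac{L\varepsilon^2}{2},\qquad\text{where } \varepsilon_f=\varepsilon\cdot\|\nabla f(x_* )\|_*.$$
   Context: Setting. $(E,\|\cdot\|)$ is a finite-dimensional normed vector space, $E^*$ its dual with norm $\|y\|_*=\max\{\langle y,x\rangle:\|x\|\le1\}$, and $X\subset E$ is a closed convex set. The functions $f,g_1,\dots,g_M:X\to\mathbb{R}$ are convex and subdifferentiable, and there is a constant $M_g$ with $|g_m(x)-g_m(y)|\le M_g\|x-y\|$ for all $x,y\in X$ and all $m=1,\dots,M$. Put $g(x)=\max_{1\le m\le M}g_m(x)$. The problem is: minimize $f(x)$ over $x\in X$ subject to $g_m(x)\le0$ for all $m=1,\dots,M$. It is assumed to be solvable. Prox structure. $d:X\to\mathbb{R}$ is continuously differentiable and $1$-strongly convex with respect to $\|\cdot\|$, i.e. $\langle\nabla d(x)-\nabla d(y),x-y\rangle\ge\|x-y\|^2$ for all $x,y\in X$, and $\min_{x\in X}d(x)=d(0)$. The constant $\Theta_0>0$ satisfies $d(x_* )\le\Theta_0^2$, where $x_*$ is an exact solution of the problem (if there is a set $X_*$ of solutions, it is assumed that $\min_{x_*\in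 X_*}d(x_* )\le\Theta_0^2$). The Bregman divergence is $V(x,y)=d(y)-d(x)-\langle\nabla d(x),y-x\rangle$ and, for $x\in X$, $p\in E^*$, $$\mathrm{Mirr}_x(p)=\arg\min_{u\in X}\{\langle p,u\rangle+V(x,u)\},$$ which is assumed to be easily computable. Here $\nabla f(x)$ is the gradient of $f$ and $\nabla g_m(x)$ denotes a subgradient of $g_m$ at $x$. All (sub)gradients used in the steps of the algorithm are assumed nonzero (if $\nabla f(x^k)=0$, then $x^k$ already minimizes $f$ and the method is stopped). Algorithm B. Input: $\varepsilon>0$ and $\Theta_0$ with $d(x_* )\le\Theta_0^2$. Set $x^0=\arg\min_{x\in X}d(x)$, $I=\emptyset$, $N=0$. Repeat: - If $g(x^N)\le\varepsilon$ (productive step): set $h_N=\varepsilon/\|\nabla f(x^N)\|_*$, $x^{N+1}=\mathrm{Mirr}_{x^N}(h_N\nabla f(x^N))$, and add $N$ to $I$. - Otherwise (non-productive step): $g_{m(N)}(x^N)>\varepsilon$ for some $m(N)\in\{1,\dots,M\}$; take any such $m(N)$ and set $h_N=\varepsilon/\|\nabla g_{m(N)}(x^N)\|_*^2$, $x^{N+1}=\mathrm{Mirr}_{x^N}(h_N\nabla g_{m(N)}(x^N))$. - Replace $N$ by $N+1$. Stop as soon as $\Theta_0^2\le\frac{\varepsilon^2}{2}\left(|I|+\sum_{k\notin I}\frac{1}{\|\nabla g_{m(k)}(x^k)\|_*^2}\right)$, where the sum is over $k\in\{0,\dots,N-1\}\setminus I$. Output: $\bar{x}^N=\arg\min_{x^k,\,k\in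 I}f(x^k)$.
   Formalization: Added, as the claim fails otherwise: d(0) ≥ 0; and f is convex and differentiable with L-Lipschitz gradient on a convex set containing X and the closed ball of radius ε around x_*, not only on X. *)

(* Defs.v *)
From HB Require Import structures.
From mathcomp Require Import all_boot all_order all_algebra.
From mathcomp Require Import all_classical all_reals all_analysis.

Set Implicit Arguments.
Unset Strict Implicit.
Unset Printing Implicit Defensive.

Import Order.TTheory GRing.Theory Num.Theory.
Import numFieldNormedType.Exports.

Local Open Scope classical_set_scope.
Local Open Scope ring_scope.

Section Optimization.
Context {R : realType} {E : normedModType R}.

(* Elements of the dual of E are {linear E -> R^o}; E is finite dimensional in
   the theorem, so these are all continuous and the supremum is a maximum. *)
Definition dual_norm (p : E -> R) : R :=
  sup [set p u | u in [set u : E | `|u| <= 1]].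

Definition argmin (A : set E) (h : E -> R) : set E :=
  [set x | A x /\ forall y, A y -> h x <= h y].

Definition is_subgradient (X : set E) (h : E -> R) (x : E)
    (p : {linear E -> R^o}) : Prop :=
  forall y, X y -> h x + p (y - x) <= h y.

(* Fréchet differentiability of h as a function on X: only increments inside X
   are tested, so values of h outside X are irrelevant, and at a point interior
   to X this is the usual gradient. *)
Definition is_gradient_on (X : set E) (h : E -> R)
    (Dh : E -> {linear E -> R^o}) : Prop :=
  forall x, X x -> forall e : R, 0 < e ->
    \forall y \near within X (nbhs x),
      `|h y - h x - Dh x (y - x)| <= e * `|y - x|.

Definition dual_continuous_on (X : set E) (Dh : E -> {linear E -> R^o}) : Prop :=
  forall x, X x -> dual_norm (Dh y \- Dh x) @[y --> within X (nbhs x)] --> (0 : R).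

Definition prox_function (X : set E) (d : E -> R)
    (Dd : E -> {linear E -> R^o}) : Prop :=
  [/\ is_gradient_on X d Dd, dual_continuous_on X Dd
    & forall x y, X x -> X y -> `|x - y| ^+ 2 <= Dd x (x - y) - Dd y (x - y)].

Definition bregman (d : E -> R) (Dd : E -> {linear E -> R^o}) (x y : E) : R :=
  d y - d x - Dd x (y - x).

(* The set of minimizers, a singleton when d is a prox function on a nonempty
   closed convex X. *)
Definition Mirr (X : set E) (d : E -> R) (Dd : E -> {linear E -> R^o})
    (x : E) (p : E -> R) : set E :=
  argmin X (fun u => p u + bregman d Dd x u).

Definition gmax (M : nat) (g : 'I_M.+1 -> E -> R) (x : E) : R :=
  \big[Num.max/g ord0 x]_(m < M.+1) g m x.

Definition feasible (X : set E) (M : nat) (g : 'I_M.+1 -> E -> R) : set E :=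
  [set x | X x /\ forall m, g m x <= 0].

Definition productive (M : nat) (g : 'I_M.+1 -> E -> R) (eps : R) (x : E) : bool :=
  gmax g x <= eps.

Definition stop_criterion (M : nat) (g : 'I_M.+1 -> E -> R)
    (Dg : 'I_M.+1 -> E -> {linear E -> R^o}) (eps Theta0 : R)
    (x : nat -> E) (m : nat -> 'I_M.+1) (n : nat) : bool :=
  Theta0 ^+ 2 <= eps ^+ 2 / 2 *
    (#|[pred k : 'I_n | productive g eps (x k)]|%:R
     + \sum_(k < n | ~~ productive g eps (x k))
         (dual_norm (Dg (m k) (x k)) ^+ 2)^-1).

(* The iterates are x 0, ..., x N; the later values of x are irrelevant, as are
   the values of m at productive steps. *)
Record algorithmB_run (X : set E) (f : E -> R) (Df : E -> {linear E -> R^o})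
    (M : nat) (g : 'I_M.+1 -> E -> R)
    (Dg : 'I_M.+1 -> E -> {linear E -> R^o})
    (d : E -> R) (Dd : E -> {linear E -> R^o}) (eps Theta0 : R)
    (x : nat -> E) (m : nat -> 'I_M.+1) (N : nat) : Prop := AlgorithmBRun {
  run_init : argmin X d (x 0%N);
  run_productive : forall k, (k < N)%N -> productive g eps (x k) ->
    ~ (forall u, Df (x k) u = 0) /\
    Mirr X d Dd (x k) (fun u => eps / dual_norm (Df (x k)) * Df (x k) u)
      (x k.+1);
  run_nonproductive : forall k, (k < N)%N -> ~~ productive g eps (x k) ->
    [/\ eps < g (m k) (x k),
        ~ (forall u, Dg (m k) (x k) u = 0)
      & Mirr X d Dd (x k)
          (fun u => eps / dual_norm (Dg (m k) (x k)) ^+ 2 * Dg (m k) (x k) u)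
          (x k.+1)];
  run_continue : forall n, (n < N)%N ->
    ~~ stop_criterion g Dg eps Theta0 x m n;
  run_stop : stop_criterion g Dg eps Theta0 x m N
}.

End Optimization.

(* Main.v *)
Require Import Defs.
From HB Require Import structures.
From mathcomp Require Import all_boot all_order all_algebra.
From mathcomp Require Import all_classical all_reals all_analysis.
From mathcomp Require Import ring lra.

Set Implicit Arguments.
Unset Strict Implicit.
Unset Printing Implicit Defensive.

Import Order.TTheory GRing.Theory Num.Theory.
Import numFieldNormedType.Exports.

Local Open Scope classical_set_scope.
Local Open Scope ring_scope.

(** Why the bound holds.

    A mirror step from a to a' with the functional c p, c >= 0, satisfies
      c p (a - y) <= (c |p|)^2 / 2 + V(a, y) - V(a', y)      ([mirror_step])
    for every y in X, where V is the Bregman divergence and |p| the dual norm.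
    This follows from first-order optimality of a' and strong convexity of d.

    Suppose that every productive iterate is far from the solution xs, in the
    sense that Df(x_k)(x_k - xs) > eps |Df(x_k)|.  With the step sizes of the
    algorithm, each step then decreases V(x_k, xs) by more than eps^2 / 2 times
    its weight: 1 at a productive step, 1 / |Dg|^2 at a nonproductive one, where
    the subgradient inequality gives Dg(x_k)(x_k - xs) > eps
    ([step_bregman_lt]).  Since V(x_0, xs) <= d(xs) <= Theta0^2 and V >= 0, the
    total weight is too small for the stopping criterion.  So some productive
    iterate a satisfies Df(a)(a - xs) <= eps |Df(a)|
    ([exists_close_productive_step]); in particular there is a productive step.

    For such an a, take u in the unit ball with Df(a)(u) close to |Df(a)|, and put
    y = xs + eps u.  Then Df(a)(y - a) is nonnegative up to an arbitrarily small
    error, so f(a) <= f(y) up to that error by convexity, while smoothness at xs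
    gives f(y) <= f(xs) + eps |Df(xs)| + L eps^2 / 2 ([smooth_suboptimality]).

    Gradients are only relative to a convex set, so they are used through the
    restrictions of f and d to segments ([gradient_along_segment]).  Finite
    dimension makes each linear functional bounded ([findim_linear_bounded]), so
    that the supremum defining the dual norm is a genuine bound. *)

(** * Gradients relative to a convex set, along segments *)

Section Segments.
Context {R : realType} {E : normedModType R}.
Implicit Types (A : set E) (h : E -> R) (Dh : E -> {linear E -> R^o}).

Lemma convex_set_segment A (a b : E) (t : R) : convex_set A -> A a -> A b ->
  0 <= t <= 1 -> A (a + t *: (b - a)).
Proof.
move=> cA /mem_set Aa /mem_set Ab /andP[t0 t1].
have /set_mem := cA _ _ (Itv01 t0 t1) Ab Aa.
rewrite /conv /= scalerBl scale1r scalerBr.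
by rewrite [in X in _ -> X]addrCA.
Qed.

(** The gradient gives a first-order expansion of h along the segment from a
    to b, at every parameter t, endpoints included. *)
Lemma gradient_along_segment A h Dh (a b : E) (t e : R) :
  convex_set A -> is_gradient_on A h Dh -> A a -> A b ->
  0 <= t <= 1 -> 0 < e ->
  \forall s \near within `[0, 1] (nbhs t),
    `|h (a + s *: (b - a)) - h (a + t *: (b - a))
      - (s - t) * Dh (a + t *: (b - a)) (b - a)| <= e * `|s - t|.
Proof.
move=> cA gA Aa Ab t01 e0.
(* The factor |b - a| + 1 instead of |b - a| covers the case a = b. *)
have k0 : 0 < `|b - a| + 1 by rewrite ltr_wpDl.
have At := convex_set_segment cA Aa Ab t01.
have := gA _ At _ (divr_gt0 e0 k0).
rewrite {1}/prop_near1 /within /= => /nbhs_normP[r /= r0 Hr].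
apply/nbhs_normP; exists (r / (`|b - a| + 1)); first exact: divr_gt0.
move=> s /= str s01.
have Es : a + s *: (b - a) - (a + t *: (b - a)) = (s - t) *: (b - a).
  by rewrite opprD addrACA subrr add0r scalerBl.
have := Hr (a + s *: (b - a)).
rewrite /= !(distrC (a + t *: _)) Es linearZ /= !normrZ => H.
apply: (le_trans (H _ _)); first last.
- rewrite [leLHS](_ : _ = e * `|s - t| * (`|b - a| / (`|b - a| + 1)));
    last by ring.
  by rewrite ler_piMr ?mulr_ge0 ?(ltW e0)// ler_pdivrMr// mul1r lerDl.
- by apply: convex_set_segment => //; move: s01; rewrite in_itv.
- rewrite (le_lt_trans (y := `|s - t| * (`|b - a| + 1))) //.
    by rewrite ler_wpM2l // lerDl.
  by rewrite -ltr_pdivlMr // distrC.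
Qed.

Lemma gradient_initial_slope A h Dh (a b : E) (e : R) :
  convex_set A -> is_gradient_on A h Dh -> A a -> A b -> 0 < e ->
  exists2 s : R, 0 < s <= 1 &
    `|h (a + s *: (b - a)) - h a - s * Dh a (b - a)| <= e * s.
Proof.
move=> cA gA Aa Ab e0.
have z01 : 0 <= (0 : R) <= 1 by rewrite lexx ler01.
have := gradient_along_segment cA gA Aa Ab z01 e0.
rewrite {1}/prop_near1 /within /= => /nbhs_normP[r /= r0 Hr].
have s0 : 0 < Num.min (r / 2) 1 by rewrite lt_min divr_gt0 // ltr01.
exists (Num.min (r / 2) 1); first by rewrite s0 ge_min lexx orbT.
have := Hr (Num.min (r / 2) 1).
rewrite scale0r addr0 subr0 [`|Num.min (r / 2) 1|]gtr0_norm //; apply => /=.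
- rewrite sub0r normrN gtr0_norm // gt_min.
  by rewrite ltr_pdivrMr // ltr_pMr // ltr1n.
- by rewrite in_itv /= (ltW s0) ge_min lexx orbT.
Qed.

Lemma convex_gradient_le A h Dh (a b : E) :
  convex_set A -> convex_function A h -> is_gradient_on A h Dh ->
  A a -> A b -> h a + Dh a (b - a) <= h b.
Proof.
move=> cA ch gA Aa Ab; apply/ler_addgt0Pr => e e0.
have [s /andP[s0 s1]] := gradient_initial_slope cA gA Aa Ab e0.
rewrite ler_norml => /andP[Hs _].
have := ch (Itv01 (ltW s0) s1) _ _ (mem_set Ab) (mem_set Aa).
rewrite /conv /= scalerBl scale1r addrCA -scalerBr => Hc.
have {}Hc : h (a + s *: (b - a)) <= s * h b + (1 - s) * h a by [].
rewrite -(ler_pM2l s0); nra.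
Qed.

(** If the increment of h at a, corrected by a homogeneous l, is nonnegative on
    A, so is its directional derivative towards any point of A.  It is used with
    l = 0 for the starting point and with a linear l for mirror steps. *)
Lemma first_order_optimality A h Dh (l : E -> R) (a b : E) :
  convex_set A -> is_gradient_on A h Dh -> A a -> A b ->
  (forall (t : R) w, l (t *: w) = t * l w) ->
  (forall z, A z -> 0 <= h z - h a + l (z - a)) ->
  0 <= Dh a (b - a) + l (b - a).
Proof.
move=> cA gA Aa Ab lZ amin; apply/ler_addgt0Pr => e e0.
have [s /andP[s0 s1]] := gradient_initial_slope cA gA Aa Ab e0.
rewrite ler_norml => /andP[_ Hs].
have As : A (a + s *: (b - a)).
  by apply: convex_set_segment => //; rewrite (ltW s0).
have := amin _ As; rewrite [a + _ - a]addrAC subrr add0r lZ => Hm.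
rewrite -(ler_pM2l s0); nra.
Qed.

(** Mean value theorem for t |-> h (a + t (b - a)) - c t^2 / 2 on [0, 1].  The
    quadratic correction replaces the integration of an estimate of the gradient
    that is linear in t, both for strong convexity and for smoothness. *)
Lemma gradient_MVT_quadratic A h Dh (a b : E) (c : R) :
  convex_set A -> is_gradient_on A h Dh -> A a -> A b ->
  exists2 t : R, 0 < t < 1 &
    h b - h a - c / 2 = Dh (a + t *: (b - a)) (b - a) - c * t.
Proof.
move=> cA gA Aa Ab.
pose phi t : R := h (a + t *: (b - a)).
pose psi : R -> R := phi - (fun t : R => c / 2 * t ^+ 2).
have drv (t : R) : t \in `]0, 1[ ->
    is_derive t 1 phi (Dh (a + t *: (b - a)) (b - a) : R).
  move=> t01.
  have t01' : 0 <= t <= 1.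
    by move: t01; rewrite in_itv /= => /andP[t0 t1]; rewrite !ltW.
  have H : (fun k : R => k^-1 *: ((phi \o shift t) (k *: 1) - phi t)) @ 0^'
      --> (Dh (a + t *: (b - a)) (b - a) : R).
    apply/cvgrPdist_le => e e0.
    have /= := gradient_along_segment cA gA Aa Ab t01' e0.
    rewrite near_withinE => /nbhs_normP[r /= r0 Hr].
    have : nbhs t `]0, 1[%classic by exact: near_in_itvoo.
    move=> /nbhs_normP[r' /= r'0 Hr'].
    apply/nbhs_normP; exists (Num.min r r') => /=; first by rewrite lt_min r0.
    move=> k /=; rewrite sub0r normrN lt_min => /andP[kr kr'] k0.
    have Ek : `|t - (k + t)| = `|k| by rewrite opprD addrCA subrr addr0 normrN.
    have := Hr (k + t); rewrite /= Ek => /(_ kr) {}Hr.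
    have /= : (k + t) \in `]0, 1[ by apply: Hr'; rewrite /= Ek.
    rewrite in_itv /= => /andP[kt0 kt1].
    have {}Hr : `|phi (k + t) - phi t - k * Dh (a + t *: (b - a)) (b - a)|
        <= e * `|k|.
      by have := Hr _; rewrite addrK; apply; rewrite in_itv /= !ltW.
    rewrite distrC /= [k *: 1]mulr1.
    rewrite -(ler_pM2l (_ : 0 < `|k|)) ?normr_gt0 // -normrM mulrBr.
    by rewrite [_ *: _]/(_ * _) mulVKf // (mulrC `|k|).
  by apply: DeriveDef; [apply/cvg_ex; eexists; exact: H | exact: cvg_lim H].
have cont : {within `[0, 1], continuous phi}.
  apply/subspace_continuousP => t; rewrite /= in_itv /= => t01.
  apply/cvgrPdist_le => e e0.
  set D := Dh (a + t *: (b - a)) (b - a) : R.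
  have K0 : 0 < 1 + `|D| by rewrite ltr_wpDr.
  have /= := gradient_along_segment cA gA Aa Ab t01 ltr01.
  rewrite !near_withinE => /nbhs_normP[r /= r0 Hr].
  apply/nbhs_normP; exists (Num.min r (e / (1 + `|D|))) => /=.
    by rewrite lt_min r0 divr_gt0.
  move=> s /=; rewrite lt_min => /andP[sr se] s01.
  have := Hr _ sr s01; rewrite mul1r -/(phi s) -/(phi t) -/D => Hs.
  move: se; rewrite ltr_pdivlMr // (distrC t) => /ltW se.
  rewrite distrC (le_trans _ se) // mulrDr mulr1.
  rewrite -[phi s - phi t](subrK ((s - t) * D)) (le_trans (ler_normD _ _)) //.
  by rewrite normrM lerD2r.
have [||t t01] :=
  @MVT R psi (fun t => Dh (a + t *: (b - a)) (b - a) - c * t) 0 1 ltr01.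
- move=> t /drv dt.
  have -> : c * t = c / 2 *: ((t *: 1) *+ 2).
    rewrite [t *: 1]mulr1.
    by have -> : c * t = c / 2 * (t *+ 2) by rewrite -mulr_natl; field.
  exact: is_deriveB.
- apply/subspace_continuousP => t t01; apply: cvgB.
    by move/subspace_continuousP: cont; exact.
  apply: cvg_within_filter; apply: cvgM; first exact: cvg_cst.
  exact: exprn_continuous.
move: t01; rewrite in_itv /= => t01.
rewrite subr0 mulr1 => Ht; exists t => //; rewrite -Ht.
have E1 : a + 1 *: (b - a) = b by rewrite scale1r addrC subrK.
rewrite /psi !fctE /phi E1 scale0r addr0.
by rewrite expr1n expr0n /= mulr1 mulr0 subr0 addrAC.
Qed.
End Segments.

(** * The dual norm in finite dimension *)

Section DualNorm.
Context {R : realType} {E : normedModType R}.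

(** In coordinates v, the norm of E attains a minimum c > 0 on the compact unit
    sphere of 'rV_n, so that c |v| <= |u| for the vector u of coordinates v;
    and p u <= |v| \sum_i |p e_i|. *)
Lemma findim_linear_bounded n (p : {linear E -> R^o}) : Vector.axiom n E ->
  exists K : R, forall u, p u <= K * `|u|.
Proof.
case=> v2r v2r_lin [r2v vK rK].
pose L : {linear E -> 'rV[R]_n} :=
  HB.pack v2r (GRing.isLinear.Build R E 'rV[R]_n _ v2r v2r_lin).
(* Basis of E attached to the coordinates v2r; G rebuilds a vector from its
   coordinates. *)
pose e i := r2v (delta_mx 0 i).
pose G (v : 'rV[R]_n) := \sum_i v 0 i *: e i.
have LG v : v2r (G v) = v.
  rewrite [RHS]row_sum_delta -[v2r]/(L : _ -> _) linear_sum.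
  by apply: eq_bigr => i _; rewrite linearZ /= rK.
have GL u : G (v2r u) = u by apply: (can_inj vK); rewrite LG.
have coord (v : 'rV[R]_n) i : `|v 0 i| <= `|v|.
  rewrite [leRHS]/Num.norm /= mx_normrE.
  by apply/bigmax_geP; right => /=; exists (0, i).
have cG : continuous (fun v => `|G v|).
  move=> v; apply: (continuous_comp (f := G)); last exact: norm_continuous.
  move: v; apply: continuous_big; first exact: add_continuous.
  move=> i _ v; apply: (@continuousZr_tmp _ _ _ _ (e i) v).
  exact: (@coord_continuous R 1 n 0 i).
pose S := [set v : 'rV[R]_n | `|v| = 1].
have cS : compact S.
  apply: bounded_closed_compact.
    exists 1; split => // x x1 v /= ->; exact: ltW.
  have -> : S = Num.norm @^-1` [set 1 : R] by [].
  apply: preimage_closed; last exact: closed_eq.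
  by move=> v _; exact: norm_continuous.
have [c c0 Hc] : exists2 c : R, 0 < c & forall v, c * `|v| <= `|G v|.
  have [[v0 Sv0]|S0] := pselect (S !=set0); last first.
    (* The unit sphere is empty only when n = 0. *)
    exists 1 => // v; have [->|v0] := eqVneq v 0; first by rewrite normr0 mulr0.
    exfalso; apply: S0; exists (`|v|^-1 *: v).
    by rewrite /S /= normrZ normfV normr_id mulVf ?normr_eq0.
  have cGS : {within S, continuous (fun v => `|G v|)}.
    exact: continuous_subspaceT.
  have [w /set_mem Sw wmin] :=
    compact_EVT_min (ex_intro _ v0 Sv0) cS cGS.
  exists `|G w|.
    rewrite normr_gt0; apply/eqP => Gw0.
    have : w = 0 by rewrite -(LG w) Gw0 -[v2r]/(L : _ -> _) linear0.
    move=> w0; move: Sw; rewrite /S /= w0 normr0 => /esym/eqP.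
    by rewrite oner_eq0.
  move=> v; have [->|vn0] := eqVneq v 0; first by rewrite normr0 mulr0.
  have vp : 0 < `|v| by rewrite normr_gt0.
  have Sv : S (`|v|^-1 *: v).
    by rewrite /S /= normrZ normfV normr_id mulVf ?normr_eq0.
  have := wmin _ (mem_set Sv).
  have -> : G (`|v|^-1 *: v) = `|v|^-1 *: G v.
    by rewrite /G scaler_sumr; apply: eq_bigr => i _; rewrite mxE scalerA.
  by rewrite normrZ normfV normr_id ler_pdivlMl // mulrC.
exists (c^-1 * \sum_i `|p (e i)|) => u.
rewrite -{1}(GL u) /G linear_sum mulrAC.
apply: (le_trans (y := `|v2r u| * \sum_i `|p (e i)|)).
  rewrite mulr_sumr; apply: ler_sum => i _; rewrite linearZ /=.
  apply: (le_trans (ler_norm _)); rewrite normrM.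
  exact: ler_wpM2r.
apply: ler_wpM2r; first exact: sumr_ge0.
by rewrite ler_pdivlMl // -{2}(GL u).
Qed.

Section FiniteDimension.
Context {n : nat} (E_findim : Vector.axiom n E).
Implicit Type p : {linear E -> R^o}.

Lemma dual_ball_has_sup p : has_sup [set p u | u in [set u : E | `|u| <= 1]].
Proof.
split; first by exists (p 0), 0 => //=; rewrite normr0.
have [K HK] := findim_linear_bounded p E_findim.
exists `|K| => _ [u /= u1 <-]; rewrite (le_trans (HK u)) //.
rewrite (le_trans (ler_norm _)) // normrM normr_id.
by rewrite -[leRHS]mulr1 ler_wpM2l.
Qed.

Lemma le_dual_norm p u : p u <= dual_norm p * `|u|.
Proof.
have [->|u0] := eqVneq u 0; first by rewrite linear0 normr0 mulr0.
have up : 0 < `|u| by rewrite normr_gt0.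
rewrite -ler_pdivrMr // mulrC.
apply: (sup_upper_bound (dual_ball_has_sup p)) => /=.
exists (`|u|^-1 *: u); last by rewrite linearZ.
by rewrite /= normrZ normfV normr_id mulVf // normr_eq0.
Qed.

Lemma dual_norm_ge0 p : 0 <= dual_norm p.
Proof.
apply: (sup_upper_bound (dual_ball_has_sup p)) => /=.
by exists 0; rewrite /= ?normr0 ?linear0.
Qed.

Lemma dual_norm_gt0 p : ~ (forall u, p u = 0) -> 0 < dual_norm p.
Proof.
move=> pn0; rewrite lt_neqAle dual_norm_ge0 andbT eq_sym; apply/eqP => p0.
apply: pn0 => u; apply/eqP; rewrite eq_le.
have := le_dual_norm p u; have := le_dual_norm p (- u).
by rewrite p0 !mul0r linearN /= oppr_le0 => -> ->.
Qed.

Lemma dual_norm_adherent p (e : R) : 0 < e ->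
  exists2 u, `|u| <= 1 & dual_norm p - e < p u.
Proof.
move=> /sup_adherent /(_ (dual_ball_has_sup p)) [_ [u u1 <-] pu].
by exists u.
Qed.

End FiniteDimension.
End DualNorm.

(** * Strong convexity, smoothness and the mirror step *)

Section Smooth.
Context {R : realType} {E : normedModType R}.
Context {n : nat} (E_findim : Vector.axiom n E).

(** [linearZ] with the scaling of R^o read as the product of R. *)
Lemma linear_formZ (p : {linear E -> R^o}) (t : R) u :
  p (t *: u) = t * p u :> R.
Proof. by rewrite linearZ. Qed.

Lemma prox_bregman_ge (X : set E) (d : E -> R) (Dd : E -> {linear E -> R^o})
    x y :
  convex_set X -> prox_function X d Dd -> X x -> X y ->
  `|y - x| ^+ 2 / 2 <= bregman d Dd x y.
Proof.
move=> cX [gd _ mono] Xx Xy; rewrite /bregman.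
have [t /andP[t0 t1]] := gradient_MVT_quadratic (`|y - x| ^+ 2) cX gd Xx Xy.
have Xz : X (x + t *: (y - x)).
  by apply: convex_set_segment => //; rewrite !ltW.
move: (mono _ _ Xz Xx); rewrite [x + _ - x]addrAC subrr add0r.
set z := x + _; rewrite !linear_formZ normrZ (gtr0_norm t0) => Hm He.
(* Monotonicity at z and x, divided by t. *)
have {Hm} : t * `|y - x| ^+ 2 <= Dd z (y - x) - Dd x (y - x).
  by rewrite -(ler_pM2l t0) mulrBr mulrA -expr2 -exprMn.
lra.
Qed.

Lemma smooth_upper_bound (Q : set E) (f : E -> R) (Df : E -> {linear E -> R^o})
    (L : R) x y :
  convex_set Q -> is_gradient_on Q f Df ->
  (forall x y, Q x -> Q y -> dual_norm (Df x \- Df y) <= L * `|x - y|) ->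
  Q x -> Q y ->
  f y <= f x + Df x (y - x) + L * `|y - x| ^+ 2 / 2.
Proof.
move=> cQ gf smooth Qx Qy.
have [t /andP[t0 t1]] := gradient_MVT_quadratic (L * `|y - x| ^+ 2) cQ gf Qx Qy.
have Qz : Q (x + t *: (y - x)).
  by apply: convex_set_segment => //; rewrite !ltW.
move: (smooth _ _ Qz Qx); rewrite [x + _ - x]addrAC subrr add0r.
set z := x + _; rewrite normrZ (gtr0_norm t0) => Hs He.
have := le_dual_norm E_findim (Df z \- Df x) (y - x).
have := ler_wpM2r (normr_ge0 (y - x)) Hs => {}Hs.
move=> /le_trans /(_ Hs) /= {}Hs.
have {}Hs : Df z (y - x) - Df x (y - x) <= L * `|y - x| ^+ 2 * t.
  by apply: (le_trans Hs); rewrite le_eqVlt; apply/orP; left; apply/eqP; ring.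
lra.
Qed.

Lemma smooth_constant_ge0 (Q : set E) (Df : E -> {linear E -> R^o})
    (L : R) x y :
  (forall x y, Q x -> Q y -> dual_norm (Df x \- Df y) <= L * `|x - y|) ->
  Q x -> Q y -> x != y -> 0 <= L.
Proof.
move=> smooth Qx Qy xy.
rewrite -(pmulr_lge0 _ (_ : 0 < `|x - y|)) ?normr_gt0 ?subr_eq0 //.
exact: le_trans (dual_norm_ge0 E_findim (Df x \- Df y)) (smooth _ _ Qx Qy).
Qed.

(** The positive part of Df a (a - xs) / |Df a| is the distance from xs to the
    half-space Df a (_ - a) >= 0, on which f >= f a within Q.  When it is at most
    eps, the suboptimality of a is bounded by the growth of f on the ball of
    radius eps about xs. *)
Lemma smooth_suboptimality (Q : set E) (f : E -> R)
    (Df : E -> {linear E -> R^o}) (L eps : R) a xs :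
  convex_set Q -> convex_function Q f -> is_gradient_on Q f Df ->
  (forall x y, Q x -> Q y -> dual_norm (Df x \- Df y) <= L * `|x - y|) ->
  0 < eps -> (forall y, `|y - xs| <= eps -> Q y) ->
  Q a -> ~ (forall u, Df a u = 0) ->
  Df a (a - xs) <= eps * dual_norm (Df a) ->
  f a - f xs <= eps * dual_norm (Df xs) + L * eps ^+ 2 / 2.
Proof.
move=> cQ cf gf smooth eps0 ball Qa Dn0 Hv.
have Qxs : Q xs by apply: ball; rewrite subrr normr0 ltW.
have L0 : 0 <= L.
  (* E is nontrivial since Df a <> 0, so the ball contains a point other than
     xs. *)
  have [w w0] : exists w : E, w != 0.
    apply: contrapT => none; apply: Dn0 => u.
    have [->|u0] := eqVneq u 0; first by rewrite linear0.
    by case: none; exists u.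
  apply: (smooth_constant_ge0 smooth (ball (xs + (eps / `|w|) *: w) _) Qxs).
    rewrite [xs + _]addrC addrK normrZ normrM normfV normr_id.
    by rewrite divfK ?normr_eq0 // gtr0_norm.
  rewrite -subr_eq0 [xs + _]addrC addrK scaler_eq0 negb_or w0 andbT.
  by rewrite mulf_neq0 ?invr_eq0 ?normr_eq0 // gt_eqF.
apply/ler_addgt0Pr => e e0.
(* The precision e / eps on |Df a| becomes e after scaling u by eps. *)
have [u u1 Hu] := dual_norm_adherent E_findim (Df a) (divr_gt0 e0 eps0).
have yE : xs + eps *: u - xs = eps *: u by rewrite addrC addKr.
have normy : `|eps *: u| <= eps by rewrite normrZ gtr0_norm // ler_piMr // ltW.
have Qy : Q (xs + eps *: u) by apply: ball; rewrite yE.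
have Hc := convex_gradient_le cQ cf gf Qa Qy.
have Hd := smooth_upper_bound cQ gf smooth Qxs Qy.
rewrite yE in Hd.
have Hp := le_dual_norm E_findim (Df xs) (eps *: u).
have Hp' : dual_norm (Df xs) * `|eps *: u| <= dual_norm (Df xs) * eps.
  by rewrite ler_wpM2l // (dual_norm_ge0 E_findim).
have Hq : L * `|eps *: u| ^+ 2 <= L * eps ^+ 2.
  by rewrite ler_wpM2l // ler_pXn2r // nnegrE // ltW.
have Ea : Df a (xs + eps *: u - a) = eps * Df a u - Df a (a - xs) :> R.
  by rewrite !linearB /= linearD linear_formZ; lra.
have Hu' : eps * dual_norm (Df a) - e < eps * Df a u.
  rewrite -(ltr_pM2l eps0) mulrBr in Hu.
  by rewrite mulrCA divff ?mulr1 // gt_eqF in Hu.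
lra.
Qed.

(** First-order optimality of a' reads c p (a' - y) <= V(a, y) - V(a', y) -
    V(a, a'), and c p (a - a') <= (c |p|)^2 / 2 + V(a, a'). *)
Lemma mirror_step (X : set E) (d : E -> R) (Dd : E -> {linear E -> R^o})
    (p : {linear E -> R^o}) (c : R) a a' y :
  convex_set X -> prox_function X d Dd -> X a -> X y -> 0 <= c ->
  Mirr X d Dd a (fun u => c * p u) a' ->
  c * p (a - y) <=
    (c * dual_norm p) ^+ 2 / 2 + (bregman d Dd a y - bregman d Dd a' y).
Proof.
move=> cX prox Xa Xy c0 [Xa' amin].
have gd : is_gradient_on X d Dd by case: prox.
have lZ (t : R) w : c * p (t *: w) - Dd a (t *: w) = t * (c * p w - Dd a w).
  by rewrite !linear_formZ; ring.
have Hopt := first_order_optimality cX gd Xa' Xy lZ.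
have {Hopt} : 0 <= Dd a' (y - a') + (c * p (y - a') - Dd a (y - a')).
  apply: Hopt => z Xz; have := amin _ Xz.
  rewrite /bregman !linearB /=; lra.
have := prox_bregman_ge cX prox Xa Xa'.
have : c * p (a - a') <= (c * dual_norm p) ^+ 2 / 2 + `|a' - a| ^+ 2 / 2.
  have := ler_wpM2l c0 (le_dual_norm E_findim p (a - a')).
  rewrite (distrC a a') => /le_trans; apply.
  (* Young's inequality. *)
  by have := sqr_ge0 (c * dual_norm p - `|a' - a|); lra.
rewrite /bregman !linearB /=; lra.
Qed.

End Smooth.

(** * Runs of the algorithm *)

Section Run.
Context {R : realType} {E : normedModType R} {n : nat}.
Context (E_findim : Vector.axiom n E) (X : set E) (X_convex : convex_set X).
Context (f : E -> R) (Df : E -> {linear E -> R^o}).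
Context (M : nat) (g : 'I_M.+1 -> E -> R).
Context (Dg : 'I_M.+1 -> E -> {linear E -> R^o}).
Context (d : E -> R) (Dd : E -> {linear E -> R^o}).
Context (d_prox : prox_function X d Dd).
Context (eps Theta0 : R) (x : nat -> E) (m : nat -> 'I_M.+1) (N : nat).
Context (run : algorithmB_run X f Df g Dg d Dd eps Theta0 x m N).

(** The contribution of step k to the stopping criterion: productive and
    nonproductive steps are thereby summed together. *)
Definition step_weight (k : nat) : R :=
  if productive g eps (x k) then 1
  else (dual_norm (Dg (m k) (x k)) ^+ 2)^-1.

Lemma stop_criterionE k : stop_criterion g Dg eps Theta0 x m k =
  (Theta0 ^+ 2 <= eps ^+ 2 / 2 * \sum_(i < k) step_weight i).
Proof.
rewrite /stop_criterion.
rewrite [in RHS](bigID (fun i : 'I_k => productive g eps (x i))) /=.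
congr (_ <= _ * (_ + _)).
  rewrite -sum1_card natr_sum; apply: eq_bigr => i.
  by rewrite unfold_in /= /step_weight => ->.
by apply: eq_bigr => i /negPf; rewrite /step_weight => ->.
Qed.

Lemma run_iterate k : (k <= N)%N -> X (x k).
Proof.
case: k => [_|k kN]; first by case: (run_init run).
have [prod|nprod] := boolP (productive g eps (x k)).
  by have [_ []] := run_productive run kN prod.
by have [_ _ []] := run_nonproductive run kN nprod.
Qed.

Lemma bregman_initial_le y : X y -> 0 <= d (x 0%N) ->
  bregman d Dd (x 0%N) y <= d y.
Proof.
move=> Xy d0; have [Xx0 xmin] := run_init run.
have gd : is_gradient_on X d Dd by case: d_prox.
have lZ (t : R) (w : E) : 0 = t * 0 :> R by rewrite mulr0.
have H := first_order_optimality X_convex gd Xx0 Xy lZ.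
have {}H : 0 <= Dd (x 0%N) (y - x 0%N) + 0.
  by apply: H => z Xz; rewrite addr0 subr_ge0 xmin.
rewrite /bregman; lra.
Qed.

Context (eps_gt0 : 0 < eps).
Context (g_subgrad : forall i z, X z -> is_subgradient X (g i) z (Dg i z)).

(** In the Bregman divergence, a nonproductive step gets closer to every
    feasible y, and a productive one does if the iterate is far enough from y,
    by more than eps ^+ 2 / 2 times the weight of the step. *)
Lemma step_bregman_lt y k : (k < N)%N -> feasible X g y ->
  (productive g eps (x k) -> eps * dual_norm (Df (x k)) < Df (x k) (x k - y)) ->
  bregman d Dd (x k.+1) y + eps ^+ 2 / 2 * step_weight k
    < bregman d Dd (x k) y.
Proof.
move=> kN [Xy gy] Hfar; have Xk := run_iterate (ltnW kN).
rewrite /step_weight; case: ifPn => [prod|nprod].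
- have [/(dual_norm_gt0 E_findim) D0 mir] := run_productive run kN prod.
  have c0 : 0 < eps / dual_norm (Df (x k)) by exact: divr_gt0.
  have := mirror_step E_findim X_convex d_prox Xk Xy (ltW c0) mir.
  have := Hfar prod; rewrite -(ltr_pM2l c0).
  rewrite mulrCA !divfK ?gt_eqF //; lra.
- have [gbig /(dual_norm_gt0 E_findim) D0 mir] :=
    run_nonproductive run kN nprod.
  set D := dual_norm _ in D0 mir *.
  have c0 : 0 < eps / D ^+ 2 by rewrite divr_gt0 ?exprn_gt0.
  have := mirror_step E_findim X_convex d_prox Xk Xy (ltW c0) mir.
  have : eps < Dg (m k) (x k) (x k - y).
    have := g_subgrad (m k) Xk Xy; have := gy (m k).
    rewrite !linearB /=; lra.
  rewrite -(ltr_pM2l c0) -/D.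
  have -> : (eps / D ^+ 2 * D) ^+ 2 = eps ^+ 2 * (D ^+ 2)^-1.
    by field; rewrite gt_eqF.
  have -> : eps / D ^+ 2 * eps = eps ^+ 2 * (D ^+ 2)^-1.
    by field; rewrite gt_eqF.
  lra.
Qed.

Lemma exists_close_productive_step y : 0 < Theta0 -> feasible X g y ->
  0 <= d (x 0%N) -> d y <= Theta0 ^+ 2 ->
  exists2 k, (k < N)%N & productive g eps (x k) /\
    Df (x k) (x k - y) <= eps * dual_norm (Df (x k)).
Proof.
move=> Theta0_gt0 feas_y d0 dy; have Xy := feas_y.1.
apply: contrapT => none.
have far k : (k < N)%N ->
    bregman d Dd (x k.+1) y + eps ^+ 2 / 2 * step_weight k
      < bregman d Dd (x k) y.
  move=> kN; apply: step_bregman_lt => // prod.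
  by rewrite ltNge; apply/negP => near; apply: none; exists k.
have sums k : (k < N)%N -> bregman d Dd (x k.+1) y
    + eps ^+ 2 / 2 * \sum_(i < k.+1) step_weight i < bregman d Dd (x 0%N) y.
  elim: k => [|k IHk] kN; first by rewrite big_ord1; exact: far.
  rewrite big_ord_recr /= mulrDr.
  by have := far _ kN; have := IHk (ltnW kN); lra.
have := run_stop run; rewrite stop_criterionE.
have V0 := bregman_initial_le Xy d0.
case: {far none} N sums (run_iterate (leqnn N)) => [_ _|k sums Xk].
  (* The criterion fails for N = 0, where the sum is empty. *)
  by rewrite big_ord0 mulr0 leNgt exprn_gt0.
have := prox_bregman_ge X_convex d_prox Xk Xy.
have := sqr_ge0 `|y - x k.+1|; have := sums k (ltnSn k); lra.
Qed.
End Run.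

(* Q is the domain on which f is convex and smooth.  Taking Q = X is allowed as
   soon as X contains the ball of radius eps around the solution; Q = setT is
   the case where f is convex and L-smooth on the whole space.  The bound on d xs
   presupposes a prox function normalised to be nonnegative (usually d 0 = 0). *)
Theorem corollary1 (R : realType) (E : normedModType R) (n : nat)
  (E_findim : Vector.axiom n E)
  (X : set E) (X_closed : closed X) (X_convex : convex_set X)
  (Q : set E) (Q_convex : convex_set Q) (XQ : X `<=` Q)
  (f : E -> R) (Df : E -> {linear E -> R^o}) (L : R)
  (f_convex : convex_function Q f)
  (f_grad : is_gradient_on Q f Df)
  (f_smooth : forall x y, Q x -> Q y ->
     dual_norm (Df x \- Df y) <= L * `|x - y|)
  (M : nat) (g : 'I_M.+1 -> E -> R)
  (Dg : 'I_M.+1 -> E -> {linear E -> R^o}) (Mg : R)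
  (g_convex : forall m, convex_function X (g m))
  (g_subgrad : forall m x, X x -> is_subgradient X (g m) x (Dg m x))
  (g_lipschitz : forall m x y, X x -> X y ->
     `|g m x - g m y| <= Mg * `|x - y|)
  (d : E -> R) (Dd : E -> {linear E -> R^o})
  (d_prox : prox_function X d Dd)
  (d_min : argmin X d 0) (d_ge0 : 0 <= d 0)
  (eps Theta0 : R) (eps_gt0 : 0 < eps) (Theta0_gt0 : 0 < Theta0)
  (xs : E) (xs_sol : argmin (feasible X g) f xs)
  (xs_bound : d xs <= Theta0 ^+ 2)
  (xs_ball : forall y, `|y - xs| <= eps -> Q y)
  (x : nat -> E) (m : nat -> 'I_M.+1) (N : nat)
  (run : algorithmB_run X f Df g Dg d Dd eps Theta0 x m N) :
  \big[Num.min/f (x 0%N)]_(k < N.+1) f (x k) - f xs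
    <= eps * dual_norm (Df xs) + L * eps ^+ 2 / 2.
Proof.
have [[Xxs _] fxs] := xs_sol.
have d0 : 0 <= d (x 0%N).
  by apply: le_trans d_ge0 _; case: d_min => _; apply; case: (run_init run).
have [k kN [prod close]] := exists_close_productive_step E_findim X_convex
  d_prox run eps_gt0 g_subgrad Theta0_gt0 (proj1 xs_sol) d0 xs_bound.
apply: (@le_trans _ _ (f (x k) - f xs)).
  rewrite lerD2r.
  have kN1 : (k < N.+1)%N by exact: ltnW.
  exact: (@bigmin_inf _ _ _ (f (x 0%N)) (Ordinal kN1)).
have [Dk0 _] := run_productive run kN prod.
apply: (smooth_suboptimality E_findim Q_convex f_convex f_grad f_smooth) => //.
exact/XQ/(run_iterate run (ltnW kN)).
Qed.
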